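(* Consider the planar quadratic system with real coefficients $$\dot x=a_1x+a_2y+a_3x^2+a_4y^2+a_5xy,\qquad \dot y=b_1x+b_2y+b_3x^2+b_4y^2+b_5xy.$$ If $$a_3=a_4=a_5=b_1=b_2=b_3=0,\quad b_4=a_2\quad\text{and}\quad b_5=a_1,$$ then for every $m\in\mathbb{R}$ the exponential curve $y=me^x$ is invariant under the flow of the system.
   Context: A set $S\subseteq\mathbb{R}^2$ is invariant under the flow $\Phi_t$ of a planar system if $\Phi_t(X_0)\in S$ for every $X_0\in S$ and every $t$ in the maximal interval of existence $I(X_0)$ of the solution with initial value $X_0$. *)

(* Defs.v *)
From mathcomp Require Import all_boot all_order all_algebra.
From mathcomp Require Import all_classical all_reals all_analysis.

Set Implicit Arguments.
Unset Strict Implicit.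
Unset Printing Implicit Defensive.

Import Order.TTheory GRing.Theory Num.Theory.
Import numFieldNormedType.Exports.

Local Open Scope classical_set_scope.
Local Open Scope ring_scope.

Definition quadratic_field (R : realType) (a1 a2 a3 a4 a5 b1 b2 b3 b4 b5 : R)
    (X : R * R) : R * R :=
  let: (x, y) := X in
  (a1 * x + a2 * y + a3 * x ^+ 2 + a4 * y ^+ 2 + a5 * x * y,
   b1 * x + b2 * y + b3 * x ^+ 2 + b4 * y ^+ 2 + b5 * x * y).

(* Since [phi] is a total function, its values outside [J] are irrelevant;
   [J] being open, the derivative at a point of [J] only involves values of
   [phi] on [J]. *)
Definition is_solution (R : realType) (F : R * R -> R * R) (X0 : R * R)
    (J : set R) (phi : R -> R * R) : Prop :=
  [/\ open J, is_interval J, J 0, phi 0 = X0 &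
      forall t, J t ->
        is_derive t (1 : R) (fun s => (phi s).1) (F (phi t)).1 /\
        is_derive t (1 : R) (fun s => (phi s).2) (F (phi t)).2].

(* The maximal interval I(X0) is the union of the open intervals around 0 on
   which a solution starting at X0 exists. *)
Definition maximal_interval (R : realType) (F : R * R -> R * R) (X0 : R * R) :
    set R :=
  [set t | exists J phi, is_solution F X0 J phi /\ J t].

(* Phi_t(X0): the value at time t of the solution starting at X0. For a locally
   Lipschitz F, such as a polynomial field, any two solutions agree on the
   intersection of their intervals, so for t in I(X0) the set below is a
   singleton. For t outside I(X0) it is empty and the value X0 is junk. *)
Definition flow (R : realType) (F : R * R -> R * R) (t : R) (X0 : R * R) :
    R * R :=
  xget X0 [set X | exists J phi, [/\ is_solution F X0 J phi, J t & phi t = X]].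

Definition flow_invariant (R : realType) (F : R * R -> R * R)
    (S : set (R * R)) : Prop :=
  forall X0, S X0 -> forall t, maximal_interval F X0 t -> S (flow F t X0).

Definition exponential_curve (R : realType) (m : R) : set (R * R) :=
  [set X | X.2 = m * expR X.1].

(* Main.v *)
(* Under the hypotheses the system reads x' = a1 x + a2 y, y' = y x', so that
   y exp(-x) is a first integral; on the curve y = m exp(x) its value is m. *)
Require Import Defs.
From mathcomp Require Import all_boot all_order all_algebra.
From mathcomp Require Import all_classical all_reals all_analysis.
From mathcomp Require Import ring.

Set Implicit Arguments.
Unset Strict Implicit.
Unset Printing Implicit Defensive.

Import Order.TTheory GRing.Theory Num.Theory.
Import numFieldNormedType.Exports.

Local Open Scope classical_set_scope.
Local Open Scope ring_scope.

(** The second equation becomes y' = a2 y^2 + a1 x y = y (a1 x + a2 y) = y x', so y e^(-x) has zero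
    derivative along any solution ([is_derive_mul_expRN]). By the mean value theorem it is constant
    on the solution's interval ([is_derive_0_interval_cst]), hence keeps its initial value m, which
    says y = m e^x at every time. *)

Lemma is_derive_0_interval_cst (R : realType) (J : set R) (f : R -> R) :
  is_interval J -> (forall t, J t -> is_derive t (1 : R) f 0) ->
  forall s t, J s -> J t -> f s = f t.
Proof.
move=> J_itv f'0 s t.
wlog le_st : s t / s <= t => [wlog_le Js Jt|Js Jt].
  have [/wlog_le->//|/ltW/wlog_le->//] := leP s t.
have st_J x : x \in `[s, t] -> J x by rewrite in_itv /=; exact: J_itv.
have [|x xst||c _] := @MVT_segment R f (fun=> 0) s t.
- exact: le_st.
- exact/f'0/st_J/subset_itv_oo_cc.
- by apply: derivable_within_continuous => x /st_J/f'0[].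
by rewrite mul0r => /subr0_eq.
Qed.

(** When y' = y x', the two terms of the product rule, y x' e^(-x) and -y x' e^(-x), cancel. *)
Lemma is_derive_mul_expRN (R : realType) (x y : R -> R) (t dx : R) :
  is_derive t (1 : R) x dx -> is_derive t (1 : R) y (y t * dx) ->
  is_derive t (1 : R) (fun s => y s * expR (- x s)) 0.
Proof.
move=> x' y'.
have e' : is_derive t (1 : R) (expR \o - x) (expR (- x t) * - dx).
  exact: is_derive1_comp.
apply: is_derive_eq (is_deriveM y' e') _.
by rewrite /= /GRing.scale /=; ring.
Qed.

Theorem theorem3p9 (R : realType) (a1 a2 a3 a4 a5 b1 b2 b3 b4 b5 : R)
    (ha3 : a3 = 0) (ha4 : a4 = 0) (ha5 : a5 = 0)
    (hb1 : b1 = 0) (hb2 : b2 = 0) (hb3 : b3 = 0)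
    (hb4 : b4 = a2) (hb5 : b5 = a1) :
  forall m : R,
    flow_invariant (quadratic_field a1 a2 a3 a4 a5 b1 b2 b3 b4 b5)
      (exponential_curve m).
Proof.
move=> m X0 X0m t [J [phi [phi_sol Jt]]].
(* The value of [flow] is [psi t] for some solution [psi] on [K], possibly different from [phi]; the
   default [X0] is ruled out because [phi t] belongs to the set. *)
rewrite /flow; case: xgetP => [X _ [{Jt phi_sol}K [psi [sol Kt <-]]]|]; last first.
  by move=> /(_ (phi t)) []; exists J, phi.
case: sol => _ K_itv K0 psi0 psi'.
have first_integral s : K s ->
    is_derive s (1 : R) (fun s => (psi s).2 * expR (- (psi s).1)) 0.
  move=> /psi'[x' y']; apply: is_derive_mul_expRN x' _.
  apply: is_derive_eq y' _; rewrite ha3 ha4 ha5 hb1 hb2 hb3 hb4 hb5.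
  by case: (psi s) => x y /=; ring.
have := is_derive_0_interval_cst K_itv first_integral Kt K0.
(* At time 0 the first integral is m e^x e^(-x) = m; its value at [t] then replaces [m] in the
   goal. *)
rewrite psi0 X0m -mulrA expRxMexpNx_1 mulr1 => <-.
by rewrite /exponential_curve /= -mulrA [expR (- _) * _]mulrC expRxMexpNx_1 mulr1.
Qed.
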